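(* Let $J$ be a cubic norm structure over a field $F$ of characteristic $0$. Let $v\in W_J$ with $q(v)\neq0$, let $k\supseteq F$ be a field extension, and let $\omega\in k$ satisfy $\omega^2=q(v)$. Then for all $x\in W_J\otimes_Fk$, $$3\,t(\omega v+v^\flat,\omega v+v^\flat,x)=\langle x,\omega v+v^\flat\rangle(\omega v+v^\flat),$$ and similarly with $\omega$ replaced by $-\omega$. In particular, the elements $\omega v\pm v^\flat$ of $W_J\otimes_Fk$ are of rank one.
   Context: **Cubic norm structures.** A cubic norm structure over $F$ is a finite-dimensional $F$-vector space $J$ with the following data: - an element $1\in J$; - a cubic polynomial map $N:J\to F$; - a quadratic polynomial map $\#:J\to J$; - a non-degenerate symmetric bilinear pairing $(\cdot,\cdot)$. Set $x\times y=(x+y)^\#-x^\#-y^\#$. The data must satisfy: - $N(1)=1$ and $1^\#=1$; - $1\times x=(1,x)-x$; - $(x^\#)^\#=N(x)x$; - $N(x+y)=N(x)+(x^\#,y)+(x,y^\#)+N(y)$; - $(x,y\times z)$ is symmetric trilinear. Write $n=N$. **The Freudenthal construction.** $W_J=F\oplus J\oplus J\oplus F$ carries the symplectic form $$\langle(a,b,c,d),(a',b',c',d')\rangle=ad'-(b,c')+(c,b')-da'$$ and the quartic form $$q((a,b,c,d))=(ad-(b,c))^2+4a\,n(c)+4d\,n(b)-4(b^\#,c^\#).$$ Let $(w,x,y,z)$ be the symmetric $4$-linear form with $(v,v,v,v)=2q(v)$, and let $t$ be the symmetric trilinear map $W_J^3\to W_J$ with $\langle w,t(x,y,z)\rangle=(w,x,y,z)$.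 Put $v^\flat=t(v,v,v)$; explicitly, for $v=(a,b,c,d)$, $v^\flat=(a^\flat,b^\flat,c^\flat,d^\flat)$ with - $a^\flat=-a^2d+a(b,c)-2n(b)$; - $b^\flat=-2c\times b^\#+2ac^\#-(ad-(b,c))b$; - $c^\flat=2b\times c^\#-2db^\#+(ad-(b,c))c$; - $d^\flat=ad^2-d(b,c)+2n(c)$. All of this extends $k$-linearly to $W_J\otimes_Fk$. An element $X$ has rank one if $X\neq0$ and $t(X,X,w)\in kX$ for all $w$. *)

(* Defs.v *)
From HB Require Import structures.
From mathcomp Require Import all_boot all_order all_algebra.
From mathcomp Require Import mpoly.

Set Implicit Arguments.
Unset Strict Implicit.
Unset Printing Implicit Defensive.

Import GRing.Theory.
Local Open Scope ring_scope.

Section PolynomialMaps.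

Variables (F : fieldType) (V U : vectType F).

(* Neither predicate depends on the choice of the bases. *)
Definition homog_poly_fun (d : nat) (f : V -> F) : Prop :=
  exists2 p : {mpoly F[\dim {:V}]},
    p \is d.-homog & forall x, f x = p.@[fun i => coord (vbasis {:V}) i x].

Definition homog_poly_map (d : nat) (f : V -> U) : Prop :=
  forall j : 'I_(\dim {:U}),
    homog_poly_fun d (fun x => coord (vbasis {:U}) j (f x)).

End PolynomialMaps.

Section Multilinear.

Variables (F : fieldType) (V U : vectType F).

Definition trilinear (f : V -> V -> V -> U) : Prop :=
  [/\ forall y z, linear (fun x => f x y z),
      forall x z, linear (fun y => f x y z)
    & forall x y, linear (fun z => f x y z)].

Definition symmetric3 (T : Type) (f : V -> V -> V -> T) : Prop :=
  forall x y z, f x y z = f y x z /\ f x y z = f x z y.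

Definition quadrilinear (f : V -> V -> V -> V -> U) : Prop :=
  [/\ forall x y z, linear (fun w => f w x y z),
      forall w y z, linear (fun x => f w x y z),
      forall w x z, linear (fun y => f w x y z)
    & forall w x y, linear (fun z => f w x y z)].

Definition symmetric4 (T : Type) (f : V -> V -> V -> V -> T) : Prop :=
  forall w x y z,
    [/\ f w x y z = f x w y z, f w x y z = f w y x z
      & f w x y z = f w x z y].

End Multilinear.

Record cubicNormStructure (F : fieldType) (J : vectType F) := CubicNormStructure {
  cone : J;
  cnorm : J -> F;
  csharp : J -> J;
  cpair : {biscalar J};
  ccross := fun x y : J => csharp (x + y) - csharp x - csharp y;
  cnorm_cubic : homog_poly_fun 3 cnorm;
  csharp_quadratic : homog_poly_map 2 csharp;
  cpair_sym : forall x y, cpair x y = cpair y x;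
  cpair_nondeg : forall x, (forall y, cpair x y = 0) -> x = 0;
  cnorm1 : cnorm cone = 1;
  csharp1 : csharp cone = cone;
  ccross1 : forall x, ccross cone x = cpair cone x *: cone - x;
  csharpK : forall x, csharp (csharp x) = cnorm x *: x;
  cnormD : forall x y,
    cnorm (x + y) = cnorm x + cpair (csharp x) y + cpair x (csharp y) + cnorm y;
  cpair_cross_trilinear :
    @trilinear F J F^o (fun x y z => cpair x (ccross y z));
  cpair_cross_sym : symmetric3 (fun x y z => cpair x (ccross y z))
}.

Section Freudenthal.

Variables (F : fieldType) (J : vectType F) (S : cubicNormStructure J).

Definition freudenthal (_ : cubicNormStructure J) : vectType F :=
  (F^o * J * J * F^o)%type.

Local Notation W := (freudenthal S).
Local Notation n := (cnorm S).
Local Notation "x ^#" := (csharp S x) (at level 2, format "x ^#").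
Local Notation "( x ,, y )" := (cpair S x y) (format "( x ,,  y )").

Definition symp (v v' : W) : F :=
  let: (a, b, c, d) := v in
  let: (a', b', c', d') := v' in
  a * d' - (b ,, c') + (c ,, b') - d * a'.

Definition quartic (v : W) : F :=
  let: (a, b, c, d) := v in
  (a * d - (b ,, c)) ^+ 2 + 4 * a * n c + 4 * d * n b - 4 * (b^# ,, c^#).

(* In characteristic 0 exactly one q4 satisfies the first predicate, and for
   that q4 exactly one t satisfies the second. *)
Definition is_quartic_polarization (q4 : W -> W -> W -> W -> F) : Prop :=
  [/\ @quadrilinear F W F^o q4, symmetric4 q4
    & forall v, q4 v v v v = 2 * quartic v].

Definition is_triple_product (q4 : W -> W -> W -> W -> F)
    (t : W -> W -> W -> W) : Prop :=
  [/\ trilinear t, symmetric3 t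
    & forall w x y z, symp w (t x y z) = q4 w x y z].

End Freudenthal.

Section ScalarExtension.

Variables (F k : fieldType) (iota : {rmorphism F -> k}).

(* V (x)_F k in coordinates: the chosen basis of V becomes the standard basis
   of k^(\dim V), and [emb] is the map v |-> v (x) 1. *)
Definition scalext (V : vectType F) : vectType k := 'rV[k]_(\dim {:V}).

Definition emb (V : vectType F) (v : V) : scalext V :=
  \row_i iota (coord (vbasis {:V}) i v).

Definition bvec (V : vectType F) (i : 'I_(\dim {:V})) : V :=
  tnth (vbasis {:V}) i.

(* The k-multilinear extensions of multilinear maps, through their values on
   the basis. *)
Definition ext2 (V : vectType F) (f : V -> V -> F) (x y : scalext V) : k :=
  \sum_i \sum_j x 0 i * y 0 j * iota (f (bvec i) (bvec j)).

Definition ext3 (V U : vectType F) (f : V -> V -> V -> U)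
    (x y z : scalext V) : scalext U :=
  \sum_i \sum_j \sum_l
    (x 0 i * y 0 j * z 0 l) *: emb (f (bvec i) (bvec j) (bvec l)).

Lemma embP (V : vectType F) (a : F) (u v : V) :
  emb (a *: u + v) = iota a *: emb u + emb v.
Proof. by apply/rowP => i; rewrite !mxE linearP rmorphD rmorphM. Qed.

Lemma sum_emb (V U : vectType F) (f : V -> U) (v : V) :
  linear f -> emb (f v) = \sum_i emb v 0 i *: emb (f (bvec i)).
Proof.
move=> linf.
have f0: f 0 = 0 by have:= linf (-1) 0 0; rewrite scaler0 addr0 scaleN1r addNr.
have emb0: emb (0 : U) = 0 by apply/rowP => i; rewrite !mxE linear0 rmorph0.
rewrite {1}(coord_vbasis (memvf v)).
under [RHS]eq_bigr do rewrite mxE.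
elim/big_rec2: _ => [|i y1 y2 _ <-]; first by rewrite f0.
by rewrite linf embP /bvec (tnth_nth 0).
Qed.

Lemma ext2_emb (V : vectType F) (f : V -> V -> F) (x y : V) :
    (forall z, linear (fun u => f u z : F^o)) ->
    (forall z, linear (fun u => f z u : F^o)) ->
  ext2 f (emb x) (emb y) = iota (f x y).
Proof.
have E (g : V -> F^o) v : linear g ->
    iota (g v) = \sum_i emb v 0 i * iota (g (bvec i)).
  move=> ling; have g0: g 0 = 0.
    by have:= ling (-1) 0 0; rewrite scaler0 addr0 scaleN1r addNr.
  rewrite {1}(coord_vbasis (memvf v)).
  under [RHS]eq_bigr do rewrite mxE.
  elim/big_rec2: _ => [|i y1 y2 _ <-]; first by rewrite g0 rmorph0.
  by rewrite ling rmorphD rmorphM /bvec (tnth_nth 0).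
move=> linl linr; rewrite (E (fun u => f u y)) //; apply: eq_bigr => i _.
by rewrite (E (f (bvec i))) // mulr_sumr; apply: eq_bigr => j _; rewrite mulrA.
Qed.

Lemma ext3_emb (V U : vectType F) (f : V -> V -> V -> U) (x y z : V) :
  trilinear f -> ext3 f (emb x) (emb y) (emb z) = emb (f x y z).
Proof.
case=> lin1 lin2 lin3.
rewrite (sum_emb x (lin1 y z)); apply: eq_bigr => i _.
rewrite (sum_emb y (lin2 _ z)) scaler_sumr; apply: eq_bigr => j _.
rewrite (sum_emb z (lin3 _ _)) !scaler_sumr; apply: eq_bigr => l _.
by rewrite !scalerA.
Qed.

End ScalarExtension.

Definition rank_one (k : fieldType) (V : vectType k)
    (t : V -> V -> V -> V) (x : V) : Prop :=
  x != 0 /\ forall w, exists c : k, t x x w = c *: x.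

(* Main.v *)
(** Comparing the coefficients of [l] and [l ^ 2] in [2 q (v + l w)], computed
    by polarization on one side and from the explicit quartic form on the other,
    gives [t v v v = v^flat] and [3 <w, t(w, v, v)>] explicitly.  The adjoint
    identities [x ** (x^# ** y) = N x y + (x, y) x^#] and their linearization
    then give [3 <w, t(w, v, v^flat)> = <w, v> <w, v^flat>], that is, after
    polarizing in [w],

      [6 t(v, v^flat, w) = <w, v> v^flat + <w, v^flat> v].            (A)

    Replacing [v] by [v + l v^flat] in (A) and taking the coefficient of [l]
    yields

      [3 q(v) t(v, v, w) + 3 t(v^flat, v^flat, w)
         = q(v) <w, v> v + <w, v^flat> v^flat].                       (B)

    For [X = omega v + v^flat], [3 t(X, X, w) = <w, X> X] is (B) plus [omega]
    times (A).  Moreover [<v, X> = 2 q(v)], so [X] is nonzero. *)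

Require Import Defs.
From HB Require Import structures.
From mathcomp Require Import all_boot all_order all_algebra.
From mathcomp Require Import mpoly ring.

Set Implicit Arguments.
Unset Strict Implicit.
Unset Printing Implicit Defensive.

Import GRing.Theory.
Local Open Scope ring_scope.

(** * Scaling of homogeneous polynomial maps *)

Lemma homog_poly_funZ (F : fieldType) (V : vectType F) d (f : V -> F) a x :
  homog_poly_fun d f -> f (a *: x) = a ^+ d * f x.
Proof.
case=> p /dhomogP p_homog fE; rewrite !fE !mevalE mulr_sumr.
apply: eq_big_seq => m /p_homog /= <-; rewrite mdegE.
under eq_bigr do rewrite linearZ /= exprMn.
by rewrite big_split /= prodrXr mulrCA.
Qed.

Lemma homog_poly_mapZ (F : fieldType) (V U : vectType F) d (f : V -> U) a x :
  homog_poly_map d f -> f (a *: x) = a ^+ d *: f x.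
Proof.
move=> f_homog; rewrite (coord_vbasis (memvf (f (a *: x)))).
rewrite [f x in RHS](coord_vbasis (memvf (f x))) scaler_sumr.
apply: eq_bigr => i _; rewrite scalerA; congr (_ *: _).
exact: (homog_poly_funZ a x (f_homog i)).
Qed.

(** Lets [ring] use a known equation: the remaining goal is a pure polynomial identity between
    differences. *)
Lemma eq_of_sub (V : zmodType) (a b c d : V) : a = b -> c - d = a - b -> c = d.
Proof. by move=> ->; rewrite subrr => /eqP; rewrite subr_eq0 => /eqP. Qed.

(** * Comparing coefficients of polynomials of degree at most 4 *)

Section CharacteristicZero.

Variables (F : fieldType) (charF0 : [pchar F] =i pred0).

Lemma natrS_neq0 n : n.+1%:R != 0 :> F.
Proof. by rewrite ((pcharf0P F).1 charF0). Qed.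

Lemma quartic_coef_eq0 (c0 c1 c2 c3 c4 : F) :
    (forall l, c0 + l * c1 + l ^+ 2 * c2 + l ^+ 3 * c3 + l ^+ 4 * c4 = 0) ->
  c1 = 0 /\ c2 = 0.
Proof.
pose f l := c0 + l * c1 + l ^+ 2 * c2 + l ^+ 3 * c3 + l ^+ 4 * c4.
move=> c_eq0; have f0 l : f l = 0 by apply: c_eq0.
split.
  apply: (mulfI (natrS_neq0 11)).
  (* Differences at 1 and 2 remove the even coefficients; the weights 8 and 1 cancel [c3]. Below,
     sums remove the odd ones, the weight 16 cancels [c4] and [30 * f 0] cancels [c0]. *)
  have -> : 12 * c1 = 8 * (f 1 - f (-1)) - (f 2 - f (-2)) by rewrite /f; ring.
  by rewrite !f0; ring.
apply: (mulfI (natrS_neq0 23)).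
have -> : 24 * c2 = 16 * (f 1 + f (-1)) - (f 2 + f (-2)) - 30 * f 0.
  by rewrite /f; ring.
by rewrite !f0; ring.
Qed.

End CharacteristicZero.

(** * Adjoint identities in a cubic norm structure *)

Section CubicNorm.

Variables (F : fieldType) (charF0 : [pchar F] =i pred0).
Variables (J : vectType F) (S : cubicNormStructure J).

Local Notation n := (cnorm S).
Local Notation "x ^#" := (csharp S x) (at level 2, format "x ^#").
Local Notation "( x ,, y )" := (cpair S x y) (format "( x ,,  y )").

(* [ccross] unfolds to a sum, which rewriting with additivity would see. *)
Definition cross := locked (ccross S).

Local Notation "x ** y" := (cross x y) (at level 40, left associativity).

Lemma crossE_def x y : x ** y = (x + y)^# - x^# - y^#.
Proof. by rewrite /cross -lock. Qed.

Lemma pairDl z x y : (x + y,, z) = (x,, z) + (y,, z).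
Proof. exact: linearDl. Qed.

Lemma pairDr z x y : (z,, x + y) = (z,, x) + (z,, y).
Proof. exact: linearDr. Qed.

Lemma pairZl z a x : (a *: x,, z) = a * (x,, z).
Proof. exact: linearZl_LR. Qed.

Lemma pairZr z a x : (z,, a *: x) = a * (z,, x).
Proof. exact: linearZr_LR. Qed.

Lemma pairNl z x : (- x,, z) = - (x,, z).
Proof. exact: linearNl. Qed.

Lemma pairNr z x : (z,, - x) = - (z,, x).
Proof. exact: linearNr. Qed.

Definition pairE := (pairDl, pairDr, pairZl, pairZr, pairNl, pairNr).

Lemma pair_inj x y : (forall z, (x,, z) = (y,, z)) -> x = y.
Proof.
move=> xy; apply/eqP; rewrite -subr_eq0; apply/eqP.
by apply: (@cpair_nondeg _ _ S) => z; rewrite pairDl pairNl xy subrr.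
Qed.

Lemma crossC x y : x ** y = y ** x.
Proof. by rewrite !crossE_def [y + x]addrC addrAC. Qed.

Lemma pair_crossCA x y z : (x,, y ** z) = (y,, x ** z).
Proof. by rewrite /cross -lock; case: (cpair_cross_sym S x y z). Qed.

(** Only the paired form [(x,, y ** z)] is assumed trilinear; non-degeneracy removes the pairing. *)
Lemma crossPl z a x y : (a *: x + y) ** z = a *: (x ** z) + y ** z.
Proof.
apply: pair_inj => u; rewrite ![(_,, u)]cpair_sym pairDr pairZr.
rewrite /cross -lock; case: (cpair_cross_trilinear S) => _ lin2 _; exact: lin2.
Qed.

Lemma crossDl z x y : (x + y) ** z = x ** z + y ** z.
Proof. by have := crossPl z 1 x y; rewrite !scale1r. Qed.

Lemma cross0l z : 0 ** z = 0.
Proof. by have := crossPl z (-1) 0 0; rewrite addr0 scaler0 scaleN1r addNr. Qed.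

Lemma crossZl z a x : (a *: x) ** z = a *: (x ** z).
Proof. by have := crossPl z a x 0; rewrite addr0 cross0l addr0. Qed.

Lemma crossNl z x : (- x) ** z = - (x ** z).
Proof. by rewrite -scaleN1r crossZl scaleN1r. Qed.

Lemma crossDr z x y : z ** (x + y) = z ** x + z ** y.
Proof. by rewrite !(crossC z) crossDl. Qed.

Lemma crossZr z a x : z ** (a *: x) = a *: (z ** x).
Proof. by rewrite !(crossC z) crossZl. Qed.

Lemma crossNr z x : z ** (- x) = - (z ** x).
Proof. by rewrite !(crossC z) crossNl. Qed.

Definition crossE := (crossDl, crossDr, crossZl, crossZr, crossNl, crossNr).

Lemma sharpD x y : (x + y)^# = x^# + x ** y + y^#.
Proof. by rewrite crossE_def -addrA subrK addrC subrK. Qed.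

Lemma sharpZ a x : (a *: x)^# = a ^+ 2 *: x^#.
Proof. exact: homog_poly_mapZ (csharp_quadratic S). Qed.

Lemma normZ a x : n (a *: x) = a ^+ 3 * n x.
Proof. exact: homog_poly_funZ (cnorm_cubic S). Qed.

Lemma crossxx x : x ** x = 2 *: x^#.
Proof.
rewrite !crossE_def -[x + x](scaler_nat 2) sharpZ -addrA -opprD.
by rewrite -[x^# + _](scaler_nat 2) -scalerBl; congr (_ *: _); ring.
Qed.

(** Euler's identity: expand [n (x + x)] with [cnormD] and compare with [8 * n x]. *)
Lemma pair_sharp x : (x,, x^#) = 3 * n x.
Proof.
apply: (mulfI (natrS_neq0 charF0 1)).
have := cnormD S x x; rewrite -[x + x](scaler_nat 2) normZ (cpair_sym S x^#).
move/esym/eq_of_sub; apply; ring.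
Qed.

(** The coefficient of [l] in [csharpK] at [x + l *: y], paired with [z]; [c0], [c2], [c3], [c4] are
    the other coefficients. *)
Lemma pair_sharp_cross x y z :
  (x^# ** (x ** y),, z) = n x * (y,, z) + (x^#,, y) * (x,, z).
Proof.
apply/eqP; rewrite -subr_eq0; apply/eqP; rewrite opprD addrA.
apply: proj1 (quartic_coef_eq0 charF0 (c0 := (x^#^#,, z) - n x * (x,, z))
  (c2 := ((x ** y)^#,, z) + (x^# ** y^#,, z)
         - (x^#,, y) * (y,, z) - (x,, y^#) * (x,, z))
  (c3 := (x ** y ** y^#,, z) - n y * (x,, z) - (x,, y^#) * (y,, z))
  (c4 := (y^#^#,, z) - n y * (y,, z)) _).
move=> l; have := congr1 (cpair S ^~ z) (csharpK S (x + l *: y)).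
rewrite /= cnormD !(sharpD, sharpZ, normZ, crossE, pairE).
move/eq_of_sub; apply.
ring.
Qed.

Lemma pair_cross_sharp x y z :
  (x ** y,, x^# ** z) = n x * (y,, z) + (x^#,, y) * (x,, z).
Proof.
rewrite -pair_sharp_cross [RHS]cpair_sym [x^# ** (x ** y)]crossC.
by rewrite [RHS]pair_crossCA (crossC z).
Qed.

(** The adjoint of [pair_sharp_cross]: multiplication by a fixed element is self-adjoint for the
    pairing. *)
Lemma cross_cross_sharp x y :
  x ** (x^# ** y) = n x *: y + (x,, y) *: x^#.
Proof.
apply: pair_inj => z; rewrite [LHS]cpair_sym crossC pair_crossCA (crossC z).
rewrite [LHS]cpair_sym pair_cross_sharp !pairE (cpair_sym S z).
by rewrite [(x,, y) * _]mulrC.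
Qed.

(** The coefficient of [l] in [pair_cross_sharp] at [x + l *: w]. *)
Lemma pair_cross_sharp_lin x w y z :
  (x ** y,, x ** w ** z) + (w ** y,, x^# ** z) =
  (x^#,, w) * (y,, z) + (x ** w,, y) * (x,, z) + (x^#,, y) * (w,, z).
Proof.
apply/eqP; rewrite -subr_eq0; apply/eqP; rewrite !opprD !addrA.
apply: proj1 (quartic_coef_eq0 charF0
  (c0 := (x ** y,, x^# ** z) - n x * (y,, z) - (x^#,, y) * (x,, z))
  (c2 := (x ** y,, w^# ** z) + (w ** y,, x ** w ** z)
         - (x,, w^#) * (y,, z) - (x ** w,, y) * (w,, z) - (w^#,, y) * (x,, z))
  (c3 := (w ** y,, w^# ** z) - n w * (y,, z) - (w^#,, y) * (w,, z))
  (c4 := 0) _).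
move=> l; have := pair_cross_sharp (x + l *: w) y z.
rewrite cnormD !(sharpD, sharpZ, normZ, crossE, pairE).
move/eq_of_sub; apply; ring.
Qed.

(* The two sides of the polarized adjoint identity at [(b, c^#)] and at
   [(c, b^#)] share their mixed term [(b^# ** y, c^# ** z)]. *)
Lemma pair_cross_sharp_sub b c y z :
  (b ** y,, b ** c^# ** z) - (c ** b^# ** y,, c ** z) =
  (b ** c^#,, y) * (b,, z) - (c ** b^#,, z) * (c,, y).
Proof.
have := pair_cross_sharp_lin c b^# z y.
have := congr1 -%R (pair_cross_sharp_lin b c^# y z).
rewrite (cpair_sym S (c ** z)) (cpair_sym S (b^# ** z)) (cpair_sym S c^# b^#).
rewrite (cpair_sym S z y).
move=> e1 e2; have := esym (congr2 +%R e1 e2).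
move/eq_of_sub; apply; ring.
Qed.

End CubicNorm.

Lemma quadrilinear_diag (F : fieldType) (W : vectType F)
    (f : W -> W -> W -> W -> F) l x y :
    @quadrilinear F W F^o f -> symmetric4 f ->
  f (x + l *: y) (x + l *: y) (x + l *: y) (x + l *: y) =
    f x x x x + l * (4 * f y x x x) + l ^+ 2 * (6 * f y y x x)
    + l ^+ 3 * (4 * f x y y y) + l ^+ 4 * f y y y y.
Proof.
case=> lin1 lin2 lin3 lin4 f_sym; rewrite [x + _]addrC.
have e1 u1 u2 u3 : f (l *: y + x) u1 u2 u3 = l * f y u1 u2 u3 + f x u1 u2 u3.
  exact: lin1.
have e2 u1 u2 u3 : f u1 (l *: y + x) u2 u3 = l * f u1 y u2 u3 + f u1 x u2 u3.
  exact: lin2.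
have e3 u1 u2 u3 : f u1 u2 (l *: y + x) u3 = l * f u1 u2 y u3 + f u1 u2 x u3.
  exact: lin3.
have e4 u1 u2 u3 : f u1 u2 u3 (l *: y + x) = l * f u1 u2 u3 y + f u1 u2 u3 x.
  exact: lin4.
have s12 u1 u2 u3 u4 : f u1 u2 u3 u4 = f u2 u1 u3 u4.
  by case: (f_sym u1 u2 u3 u4).
have s23 u1 u2 u3 u4 : f u1 u2 u3 u4 = f u1 u3 u2 u4.
  by case: (f_sym u1 u2 u3 u4).
have s34 u1 u2 u3 u4 : f u1 u2 u3 u4 = f u1 u2 u4 u3.
  by case: (f_sym u1 u2 u3 u4).
rewrite e1 !e2 !e3 !e4.
(* Each mixed term is sorted to one representative per degree, so that the binomial coefficients 4,
   6, 4 appear. *)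
rewrite (s34 x x x y) (s23 x x y x) (s12 x y x x).
rewrite (s23 x x y y) (s12 x y x y) (s12 x y y x) (s34 y x x y) (s23 y x y x).
by rewrite (s34 y y y x) (s23 y y x y) (s12 y x y y); ring.
Qed.

(** * The symplectic and quartic forms, in explicit coordinates *)

Section Freudenthal.

Variables (F : fieldType) (charF0 : [pchar F] =i pred0).
Variables (J : vectType F) (S : cubicNormStructure J).

Local Notation W := (freudenthal S).
Local Notation n := (cnorm S).
Local Notation "x ^#" := (csharp S x) (at level 2, format "x ^#").
Local Notation "( x ,, y )" := (cpair S x y) (format "( x ,,  y )").
Local Notation "x ** y" := (cross S x y) (at level 40, left associativity).

(** The explicit formula for [t v v v], stated without [t]; [triple_diag] identifies the two. *)
Definition flat (v : W) : W :=
  let: (a, b, c, d) := v in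
  let m := a * d - (b,, c) in
  (- (a * m) - 2 * n b,
   - 2 *: (c ** b^#) + (2 * a) *: c^# - m *: b,
   2 *: (b ** c^#) - (2 * d) *: b^# + m *: c,
   d * m + 2 * n c).

(* The coefficient of l ^+ 2 in quartic (v + l *: w). *)
Definition biquartic (v w : W) : F :=
  let: (a, b, c, d) := v in
  let: (a', b', c', d') := w in
  (a * d' + a' * d - (b,, c') - (b',, c)) ^+ 2
  + 2 * (a * d - (b,, c)) * (a' * d' - (b',, c'))
  + 4 * (a * (c,, c'^#) + a' * (c^#,, c') + d * (b,, b'^#) + d' * (b^#,, b'))
  - 4 * ((b'^#,, c^#) + (b^#,, c'^#) + (b ** b',, c ** c')).

Lemma freudenthalPE l a b c d a' b' c' d' :
  (a, b, c, d) + l *: (a', b', c', d') =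
  (a + l * a', b + l *: b', c + l *: c', d + l * d') :> W.
Proof. by []. Qed.

Lemma sympP l (x y z : W) : symp (x + l *: y) z = symp x z + l * symp y z.
Proof.
case: x y z => [[[a b] c] d] [[[a' b'] c'] d'] [[[a'' b''] c''] d''].
by rewrite freudenthalPE /= !pairE; ring.
Qed.

Lemma sympC (x y : W) : symp x y = - symp y x.
Proof.
case: x y => [[[a b] c] d] [[[a' b'] c'] d'] /=.
by rewrite (cpair_sym S b) (cpair_sym S c); ring.
Qed.

Lemma symp_alt (x : W) : symp x x = 0.
Proof.
apply: (mulfI (natrS_neq0 charF0 1)).
by have /eq_of_sub := sympC x x; apply; ring.
Qed.

Lemma sympPr l (x y z : W) : symp z (x + l *: y) = symp z x + l * symp z y.
Proof. by rewrite sympC sympP opprD -mulrN -!sympC. Qed.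

Lemma sympDr (x y z : W) : symp z (x + y) = symp z x + symp z y.
Proof. by have := sympPr 1 x y z; rewrite scale1r mul1r. Qed.

Lemma symp0r (z : W) : symp z 0 = 0.
Proof. by have := sympPr (-1) 0 0 z; rewrite scaler0 addr0 mulN1r subrr. Qed.

Lemma sympZr l (y z : W) : symp z (l *: y) = l * symp z y.
Proof. by have := sympPr l 0 y z; rewrite add0r symp0r add0r. Qed.

Lemma symp_inj (x y : W) : (forall w, symp w x = symp w y) -> x = y.
Proof.
case: x y => [[[a b] c] d] [[[a' b'] c'] d'] xy.
have xyE := fun a b c d => xy (a, b, c, d); rewrite /= in xyE.
have p0 z : (0,, z) = 0 by exact: linear0l.
(* Vectors supported in a single coordinate isolate the opposite coordinate of [x] and [y], up to
   sign. *)
congr (_, _, _, _).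
- by have := xyE 0 0 0 (-1); rewrite !p0; move/eq_of_sub; apply; ring.
- apply: (@pair_inj _ _ S) => z; rewrite !(cpair_sym S _ z).
  by have := xyE 0 0 z 0; rewrite !p0; move/eq_of_sub; apply; ring.
- apply: (@pair_inj _ _ S) => z; rewrite !(cpair_sym S _ z).
  by have := xyE 0 (- z) 0 0; rewrite !pairE !p0; move/eq_of_sub; apply; ring.
- by have := xyE 1 0 0 0; rewrite !p0; move/eq_of_sub; apply; ring.
Qed.

(** To be read against [quadrilinear_diag]: the coefficients of [l] and [l ^+ 2] give [q4 w v v v]
    and [q4 w w v v]. *)
Lemma quartic_line l (v w : W) :
  quartic (v + l *: w) = quartic v + l * (2 * symp w (flat v))
    + l ^+ 2 * biquartic v w + l ^+ 3 * (2 * symp v (flat w))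
    + l ^+ 4 * quartic w.
Proof.
case: v w => [[[a b] c] d] [[[a' b'] c'] d']; rewrite freudenthalPE.
rewrite /= !cnormD !(sharpD, sharpZ, normZ, crossE, pairE).
have swap x y z : (x,, y ** z) = (z,, y ** x).
  by rewrite crossC pair_crossCA crossC.
(* Equal pairings are brought to one chosen form, since [ring] treats them as atoms. *)
rewrite (swap b^# c c') (cpair_sym S (b ** b')) (swap c^# b b').
rewrite (cpair_sym S (b ** b') c'^#) [b ** b']crossC (swap c'^# b' b).
rewrite [c ** c']crossC (swap b'^# c' c).
rewrite !(cpair_sym S b'^#) !(cpair_sym S c'^#) !(cpair_sym S b^#).
rewrite !(cpair_sym S c^#) !(cpair_sym S c) !(cpair_sym S c').
ring.
Qed.

(** These polarize, at [v] and [flat v], the relations [c^# = d *: b], [b^# = a *: c],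
    [(b,, c) = 3 * (a * d)] and [(b ** y,, c ** z) = (y,, c) * (b,, z) + a * d * (y,, z)], which
    hold for the vectors [(1, x, x^#, n x)]. *)
Lemma cross_flat (a : F) b c (d A : F) B C (D : F) :
  flat (a, b, c, d) = (A, B, C, D) ->
  [/\ c ** C = d *: B + D *: b, b ** B = a *: C + A *: c,
      (b,, C) + (B,, c) = 3 * (a * D + A * d)
    & forall y z, (b ** y,, C ** z) + (B ** y,, c ** z)
        = (y,, c) * (B,, z) + (y,, C) * (b,, z) + (a * D + A * d) * (y,, z)].
Proof.
have swap x y z : (x,, y ** z) = (z,, y ** x).
  by rewrite crossC pair_crossCA crossC.
case=> <- <- <- <-; split.
- apply: (@pair_inj _ _ S) => z.
  rewrite !crossE [b ** c^#]crossC (cross_cross_sharp charF0) crossxx.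
  by rewrite !pairE (cpair_sym S c b); ring.
- apply: (@pair_inj _ _ S) => z.
  rewrite !crossE [c ** b^#]crossC (cross_cross_sharp charF0) crossxx.
  by rewrite !pairE; ring.
- rewrite !pairE (cpair_sym S (c ** b^#)) (swap b b) (swap c c) !crossxx !pairE.
  rewrite (cpair_sym S c^# b^#) (cpair_sym S c^# c) !(pair_sharp charF0).
  by ring.
move=> y z; rewrite !crossE !pairE.
have := pair_cross_sharp_sub charF0 S b c y z.
have := pair_cross_sharp charF0 S b y z.
have := pair_cross_sharp charF0 S c z y.
rewrite (cpair_sym S (c ** z)) (cpair_sym S z y) => -> ->.
rewrite !(cpair_sym S y) => /(congr1 ( *%R 2))/eq_of_sub; apply; ring.
Qed.

(** The identity [3 <w, t(w, v, v^flat)> = <w, v> <w, v^flat>] in a form free of [t]: the mixed term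
    of [biquartic] is six times [q4 w w v (flat v)]. *)
Lemma biquartic_flat (v w : W) :
  biquartic (v + flat v) w =
  biquartic v w + biquartic (flat v) w + 2 * symp w v * symp w (flat v).
Proof.
case: v w => [[[a b] c] d] [[[y0 y] z] z0].
(* The coordinates of [flat v] stay opaque; only the four relations of [cross_flat] enter. *)
case flatE: (flat _) => [[[A B] C] D].
have [cC bB bC mixed] := cross_flat flatE.
rewrite -[_ + (A, B, C, D)]/((a + A, b + B, c + C, d + D) : W) /=.
rewrite !(sharpD, crossE, pairE) cC bB !pairE.
have -> : (b,, C) = 3 * (a * D + A * d) - (B,, c) by rewrite -bC addrK.
have -> : (b ** y,, C ** z) = (y,, c) * (B,, z) + (y,, C) * (b,, z)
    + (a * D + A * d) * (y,, z) - (B ** y,, c ** z) by rewrite -mixed addrK.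
rewrite (cpair_sym S c^# z) !(cpair_sym S z) !(cpair_sym S y^#).
by rewrite !(cpair_sym S y); ring.
Qed.

(** * The triple product: identities (A) and (B) *)

Section TripleProduct.

Variables (q4 : W -> W -> W -> W -> F) (q4P : is_quartic_polarization q4).
Variables (t : W -> W -> W -> W) (tP : is_triple_product q4 t).

Lemma q4_line (v w : W) :
  q4 w v v v = symp w (flat v) /\ 3 * q4 w w v v = biquartic v w.
Proof.
have [q4_lin q4_sym q4_diag] := q4P.
have [|e1 e2] := @quartic_coef_eq0 F charF0 (q4 v v v v - 2 * quartic v)
  (4 * q4 w v v v - 4 * symp w (flat v))
  (6 * q4 w w v v - 2 * biquartic v w)
  (4 * q4 v w w w - 4 * symp v (flat w)) (q4 w w w w - 2 * quartic w).
  move=> l; have := q4_diag (v + l *: w).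
  rewrite quadrilinear_diag // quartic_line.
  by move/eq_of_sub; apply; ring.
split.
  apply: (mulfI (natrS_neq0 charF0 3)).
  by move/eq_of_sub: e1; apply; ring.
apply: (mulfI (natrS_neq0 charF0 1)).
by move/eq_of_sub: e2; apply; ring.
Qed.

Lemma triple_diag v : t v v v = flat v.
Proof.
have [_ _ sympt] := tP; apply: symp_inj => w.
by rewrite sympt (q4_line v w).1.
Qed.

Lemma triple1P l x y u z : t (x + l *: y) u z = t x u z + l *: t y u z.
Proof. by case: tP => -[lin1 _ _] _ _; rewrite ![_ + l *: _]addrC -lin1. Qed.

Lemma triple_sym12 x y z : t x y z = t y x z.
Proof. by case: tP => _ t_sym _; case: (t_sym x y z). Qed.

Lemma triple_sym23 x y z : t x y z = t x z y.
Proof. by case: tP => _ t_sym _; case: (t_sym x y z). Qed.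

Lemma triple2P l x y u z : t u (x + l *: y) z = t u x z + l *: t u y z.
Proof. by rewrite triple_sym12 triple1P !(triple_sym12 _ u). Qed.

Lemma triple3P l x y u z : t u z (x + l *: y) = t u z x + l *: t u z y.
Proof. by rewrite triple_sym23 triple2P !(triple_sym23 u _ z). Qed.

Lemma sympt u x y z : symp u (t x y z) = q4 u x y z.
Proof. by case: tP. Qed.

Lemma symp_triple_swap u v x y : symp u (t v x y) = symp v (t u x y).
Proof. by rewrite !sympt; case: q4P => _ q4_sym _; case: (q4_sym u v x y). Qed.

Lemma symp_triple_diag v : symp v (t v v v) = 2 * quartic v.
Proof. by rewrite sympt; case: q4P. Qed.

(** Evaluate [3 * q4 w w v v = biquartic v w] at [v], [f] and [v + f]; the mixed term occurs twice,
    whence the initial factor 2. *)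
Lemma symp_triple_flat v w :
  3 * symp w (t w v (t v v v)) = symp w v * symp w (t v v v).
Proof.
set f := t v v v; apply: (mulfI (natrS_neq0 charF0 1)).
have := (q4_line (v + f) w).2; rewrite /f [in X in biquartic X]triple_diag.
rewrite biquartic_flat -!triple_diag -/f -!(q4_line _ w).2 -!sympt.
rewrite -[f in v + f]scale1r.
rewrite triple2P !triple3P !sympPr (triple_sym23 w f v).
by move/eq_of_sub; apply; ring.
Qed.

(** Identity (A): polarize [symp_triple_flat] in [w]. Subtracting its instances at [w] and [u] from
    the one at [w + u] leaves the terms bilinear in [w] and [u]. *)
Lemma triple_flat v w :
  6 *: t v (t v v v) w = symp w v *: t v v v + symp w (t v v v) *: v.
Proof.
set f := t v v v; apply: symp_inj => u; rewrite sympDr !sympZr.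
have swapt : symp w (t u v f) = symp u (t v f w).
  by rewrite symp_triple_swap triple_sym12 triple_sym23.
have := symp_triple_flat v (w + u); rewrite -/f.
rewrite -[u in w + u]scale1r triple1P !sympPr !sympP.
rewrite (symp_triple_swap u w) swapt.
have := symp_triple_flat v w; have := symp_triple_flat v u; rewrite -/f.
move=> e1 e2 e3.
have /eq_of_sub := congr2 (fun a b => a - b) e3 (congr2 +%R e1 e2).
apply; ring.
Qed.

(* The coefficient of [l] in [triple_flat] at [v + l *: t v v v]. *)
Lemma triple_flat_flat v w :
  3 * quartic v *: t v v w + 3 *: t (t v v v) (t v v v) w =
  quartic v * symp w v *: v + symp w (t v v v) *: t v v v.
Proof.
set q := quartic v; set f := t v v v.
(* Identity (A) at [w = v], where [symp v v = 0] and [symp v f = 2 * q]. *)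
have tvvf : 3 *: t v v f = q *: v.
  apply: (scalerI (natrS_neq0 charF0 1)); rewrite !scalerA -natrM.
  rewrite triple_sym23 triple_flat symp_alt scale0r add0r.
  by rewrite symp_triple_diag.
set h := 3 *: t v f f; set k := t f f f.
have flat_line l : t (v + l *: f) (v + l *: f) (v + l *: f) =
    f + (l * q) *: v + (l ^+ 2) *: h + l ^+ 3 *: k.
  rewrite -scalerA -tvvf; apply: symp_inj => u.
  rewrite !(triple1P, triple2P, triple3P).
  rewrite (triple_sym12 f v) (triple_sym23 v f v) (triple_sym12 f v) -/f.
  rewrite (triple_sym23 f f v) (triple_sym12 f v) -/k.
  by rewrite !sympPr !sympZr; ring.
(* [h] and [k] enter only from [l ^+ 2] on, so their values are irrelevant. The coefficient of [l]
   is twice the goal, hence the factor 2. *)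
clearbody h k; apply: symp_inj => u; rewrite !sympDr !sympZr.
apply: (mulfI (natrS_neq0 charF0 1)).
apply/eqP; rewrite -subr_eq0; apply/eqP.
apply: (proj1 (quartic_coef_eq0 charF0
  (c0 := 6 * symp u (t v f w) - symp w v * symp u f - symp w f * symp u v)
  (c2 := 6 * symp u (t v h w) + 6 * q * symp u (t v f w)
    - symp w v * symp u h - q * symp w f * symp u v
    - q * symp w v * symp u f - symp w h * symp u v)
  (c3 := 6 * symp u (t v k w) + 6 * symp u (t f h w)
    - symp w v * symp u k - symp w f * symp u h
    - symp w h * symp u f - symp w k * symp u v)
  (c4 := 6 * symp u (t f k w) - symp w f * symp u k - symp w k * symp u f) _)).
move=> l; have := congr1 (symp u) (triple_flat (v + l *: f) w).
rewrite flat_line sympDr !sympZr !(triple1P, triple2P) !(sympPr, sympZr).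
rewrite (triple_sym12 f v).
move/eq_of_sub; apply; ring.
Qed.

End TripleProduct.

End Freudenthal.

(** * Multilinear extension of scalars in coordinates *)

Section ScalarExtension.

Variables (F k : fieldType) (iota : {rmorphism F -> k}).
Variables (V U : vectType F).

Lemma emb_bvecE (i j : 'I_(\dim {:V})) : emb iota (bvec i) 0 j = (i == j)%:R.
Proof.
rewrite mxE /bvec (tnth_nth 0) coord_free ?rmorph_nat 1?eq_sym //.
exact: basis_free (vbasisP _).
Qed.

(** Reduces an identity linear in [x] to vectors coming from [V]. *)
Lemma scalext_sum (x : scalext k V) : x = \sum_i x 0 i *: emb iota (bvec i).
Proof.
apply/rowP => j; rewrite summxE (bigD1 j) //= big1 => [|i /negPf ij].
  by rewrite addr0 mxE emb_bvecE eqxx mulr1.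
by rewrite mxE emb_bvecE ij mulr0.
Qed.

Lemma ext2Pr (f : V -> V -> F) l x y z :
  ext2 iota f x (y + l *: z) = ext2 iota f x y + l * ext2 iota f x z.
Proof.
rewrite /ext2 mulr_sumr -big_split; apply: eq_bigr => i _.
rewrite mulr_sumr -big_split; apply: eq_bigr => j _.
by rewrite !mxE /=; ring.
Qed.

Lemma ext2Pl (f : V -> V -> F) l x y z :
  ext2 iota f (y + l *: z) x = ext2 iota f y x + l * ext2 iota f z x.
Proof.
rewrite /ext2 mulr_sumr -big_split; apply: eq_bigr => i _.
rewrite mulr_sumr -big_split; apply: eq_bigr => j _.
by rewrite !mxE /=; ring.
Qed.

Variable f : V -> V -> V -> U.
Local Notation fk := (ext3 iota f).

Lemma ext3P1 l x y z w :
  fk (x + l *: y) z w = fk x z w + l *: fk y z w.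
Proof.
rewrite /ext3; do 3![rewrite scaler_sumr -big_split; apply: eq_bigr => ? _].
by rewrite /= scalerA -scalerDl !mxE !mulrDl !mulrA.
Qed.

Lemma ext3P2 l x y z w :
  fk z (x + l *: y) w = fk z x w + l *: fk z y w.
Proof.
rewrite /ext3; do 3![rewrite scaler_sumr -big_split; apply: eq_bigr => ? _].
by rewrite /= scalerA -scalerDl !mxE; congr (_ *: _); ring.
Qed.

Lemma ext3P3 l x y z w :
  fk z w (x + l *: y) = fk z w x + l *: fk z w y.
Proof.
rewrite /ext3; do 3![rewrite scaler_sumr -big_split; apply: eq_bigr => ? _].
by rewrite /= scalerA -scalerDl !mxE; congr (_ *: _); ring.
Qed.

Lemma ext3NN x y z : fk (- x) (- y) z = fk x y z.
Proof. by rewrite /ext3; do 3![apply: eq_bigr => ? _]; rewrite !mxE mulrNN. Qed.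

End ScalarExtension.

(** * The rank-one elements attached to a square root of the quartic form *)

Section RankOne.

Variables (F : fieldType) (charF0 : [pchar F] =i pred0).
Variables (J : vectType F) (S : cubicNormStructure J).

Local Notation W := (freudenthal S).

Variables (q4 : W -> W -> W -> W -> F) (q4P : is_quartic_polarization q4).
Variables (t : W -> W -> W -> W) (tP : is_triple_product q4 t).
Variables (k : fieldType) (iota : {rmorphism F -> k}).

Local Notation tk := (ext3 iota t).
Local Notation sympk := (ext2 iota (@symp F J S)).

Lemma ext2_symp (x y : W) : sympk (emb iota x) (emb iota y) = iota (symp x y).
Proof.
apply: ext2_emb => z l u v; rewrite [l *: u + v]addrC.
  by rewrite sympP addrC.
by rewrite sympPr addrC.
Qed.

Lemma ext3_triple (x y z : W) :
  tk (emb iota x) (emb iota y) (emb iota z) = emb iota (t x y z).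
Proof. by apply: ext3_emb; case: tP. Qed.

Lemma embZ (V : vectType F) a (x : V) :
  emb iota (a *: x) = iota a *: emb iota x.
Proof. by apply/rowP => i; rewrite !mxE linearZ /= rmorphM. Qed.

Lemma embD (V : vectType F) (x y : V) :
  emb iota (x + y) = emb iota x + emb iota y.
Proof. by apply/rowP => i; rewrite !mxE linearD /= rmorphD. Qed.

Variables (v : W) (omega : k) (omega2 : omega ^+ 2 = iota (quartic v)).

Local Notation X := (omega *: emb iota v + emb iota (t v v v)).

Lemma triple_root_emb (w : W) :
  3 *: tk X X (emb iota w) = sympk (emb iota w) X *: X.
Proof.
rewrite [X]addrC !(ext3P1, ext3P2) !ext3_triple ext2Pr !ext2_symp.
have charF2 : 2 != 0 :> k.
  by rewrite -(rmorph_nat iota) fmorph_eq0 (natrS_neq0 charF0 1).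
have eA := congr1 (@emb _ _ iota W) (triple_flat charF0 q4P tP v w).
have eB := congr1 (@emb _ _ iota W) (triple_flat_flat charF0 q4P tP v w).
rewrite !(embD, embZ) in eA eB; rewrite (triple_sym12 tP (t v v v) v w).
apply/rowP => i; apply: (mulfI charF2).
move/rowP/(_ i): eA; move/rowP/(_ i): eB.
rewrite !(mxE, rmorphM, rmorph_nat) /= -omega2.
move=> eB eA.
(* (B) plus [omega] times (A), doubled to match the factor 2 put on the goal. *)
have /eq_of_sub := congr2 (fun a b => 2 * a + 2 * (omega * b)) eB eA.
apply; ring.
Qed.

Lemma triple_root (x : scalext k W) : 3 *: tk X X x = sympk x X *: X.
Proof.
rewrite (scalext_sum iota x); elim/big_rec: _ => [|i y _ IHy].
  (* The empty sum is itself an embedded vector, so the base case is an instance of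
     [triple_root_emb]. *)
  have z0 : 0 = emb iota (0 : W).
    by apply/rowP => i; rewrite !mxE linear0 rmorph0.
  by rewrite [X in tk _ _ X]z0 triple_root_emb -z0.
rewrite [_ + y]addrC ext3P3 ext2Pl scalerDr IHy [RHS]scalerDl; congr (_ + _).
by rewrite scalerA [3 * _]mulrC -!scalerA triple_root_emb.
Qed.

Lemma root_rank_one : quartic v != 0 -> rank_one tk X.
Proof.
move=> qv_neq0; have k3 : 3 != 0 :> k.
  by rewrite -(rmorph_nat iota) fmorph_eq0 (natrS_neq0 charF0 2).
split=> [|w]; last first.
  exists (3^-1 * sympk w X).
  by rewrite -scalerA -triple_root scalerA mulVf // scale1r.
have k2 : 2 != 0 :> k.
  by rewrite -(rmorph_nat iota) fmorph_eq0 (natrS_neq0 charF0 1).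
(* As [symp v v = 0], this pairing is [iota (2 * quartic v)], whatever [omega] is. *)
have : sympk (emb iota v) X != 0.
  rewrite [X]addrC ext2Pr !ext2_symp (symp_alt charF0) rmorph0 mulr0 addr0.
  rewrite (symp_triple_diag q4P tP) rmorphM rmorph_nat.
  by rewrite mulf_neq0 // fmorph_eq0.
apply: contra_neq => ->.
have := ext2Pr iota (@symp F J S) (-1) (emb iota v) 0 0.
by rewrite scaler0 addr0 mulN1r subrr.
Qed.

End RankOne.

Theorem theorem5p1 (F : fieldType) (charF0 : [pchar F] =i pred0)
    (J : vectType F) (S : cubicNormStructure J)
    (q4 : freudenthal S -> freudenthal S -> freudenthal S -> freudenthal S -> F)
    (q4P : is_quartic_polarization q4)
    (t : freudenthal S -> freudenthal S -> freudenthal S -> freudenthal S)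
    (tP : is_triple_product q4 t)
    (v : freudenthal S) (qv_neq0 : quartic v != 0)
    (k : fieldType) (iota : {rmorphism F -> k})
    (omega : k) (omega2 : omega ^+ 2 = iota (quartic v)) :
  let vflat := t v v v in
  let tk := ext3 iota t in
  let sympk := ext2 iota (@symp F J S) in
  let Xp := omega *: emb iota v + emb iota vflat in
  let Xm := (- omega) *: emb iota v + emb iota vflat in
  [/\ forall x : scalext k (freudenthal S), 3 *: tk Xp Xp x = sympk x Xp *: Xp,
      forall x : scalext k (freudenthal S), 3 *: tk Xm Xm x = sympk x Xm *: Xm,
      rank_one tk (omega *: emb iota v + emb iota vflat)
    & rank_one tk (omega *: emb iota v - emb iota vflat)].
Proof.
have Nomega2 : (- omega) ^+ 2 = iota (quartic v) by rewrite sqrrN.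
move=> vflat tk sympk Xp Xm; split.
- exact: (triple_root charF0 q4P tP omega2).
- exact: (triple_root charF0 q4P tP Nomega2).
- exact: (root_rank_one charF0 q4P tP omega2 qv_neq0).
have [Xm_neq0 Xm_line] : rank_one tk Xm.
  exact: (root_rank_one charF0 q4P tP Nomega2 qv_neq0).
(* [tk] is even in its first two arguments jointly, so passing from [Xm] to [- Xm] only changes the
   sign of the scalar. *)
have -> : omega *: emb iota v - emb iota vflat = - Xm.
  by rewrite opprD scaleNr opprK.
split=> [|w]; first by rewrite oppr_eq0.
have [c tkXm] := Xm_line w; exists (- c).
by rewrite /tk ext3NN -/tk tkXm scaleNr scalerN opprK.
Qed.
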